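(* Let $\mathcal L$ be a logic. The truth sets of $\mathcal L$ are small (resp. almost small) if and only if for every algebra $\mathbf A$ the Leibniz operator $\Omega^{\mathbf A}$ is order-reflecting (resp. almost order-reflecting) over $\mathcal{F}i_{\mathcal L}\mathbf A$.
   Context: Fix an algebraic type and a countably infinite set of variables; $\mathbf{Fm}$ is the formula algebra. A logic $\mathcal L$ is a structural closure operator on sets of formulas; $\Gamma\vdash_{\mathcal L}\varphi$ means $\varphi$ is in the closure of $\Gamma$. A deductive filter of $\mathcal L$ over $\mathbf A$ is $F\subseteq A$ such that $\Gamma\vdash_{\mathcal L}\varphi$ and $h[\Gamma]\subseteq F$ for a homomorphism $h\colon\mathbf{Fm}\to\mathbf A$ imply $h(\varphi)\in F$; $\mathcal{F}i_{\mathcal L}\mathbf A$ is the set of these. The Leibniz congruence $\Omega^{\mathbf A}F$ is the largest congruence of $\mathbf A$ compatible with $F$. $\mathrm{Mod}^{*}\mathcal L:=\{\langle\mathbf A,F\rangle:F\in\mathcal{F}i_{\mathcal L}\mathbf A,\ \Omega^{\mathbf A}F=\mathrm{Id}_{\mathbf A}\}$. The truth sets of $\mathcal L$ are small if for every $\langle\mathbf A,F\rangle\in\mathrm{Mod}^{*}\mathcal L$, $F$ is the smallest non-empty deductive filter of $\mathcal L$ over $\mathbf A$; almost small if this holds for every $\langle\mathbf A,F\rangle\in\mathrm{Mod}^{*}\mathcal L$ with $F\neq\emptyset$. $\Omega^{\mathbf A}$ is order-reflecting over $\mathcal{F}i_{\mathcal L}\mathbf A$ if for all $F,G\in\mathcal{F}i_{\mathcal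 L}\mathbf A$, $\Omega^{\mathbf A}F\subseteq\Omega^{\mathbf A}G$ implies $F\subseteq G$; almost order-reflecting if this holds for all non-empty $F,G\in\mathcal{F}i_{\mathcal L}\mathbf A$. *)

(* Defs.v *)
From mathcomp Require Import all_boot.
From mathcomp Require Import boolp classical_sets functions cardinality.
From Stdlib Require Import Relation_Operators Operators_Properties.

Set Implicit Arguments.
Unset Strict Implicit.
Unset Printing Implicit Defensive.

Local Open Scope classical_set_scope.
Local Open Scope card_scope.

Record signature := Signature {
  symbol :> Type;
  arity : symbol -> nat
}.

(* As usual in universal algebra, the universe of an algebra is non-empty. *)
Record algebra (S : signature) := Algebra {
  carrier :> Type;
  carrier_inhabited : inhabited carrier;
  interp : forall f : S, ('I_(arity f) -> carrier) -> carrier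
}.

Definition homomorphism (S : signature) (A B : algebra S) (h : A -> B) : Prop :=
  forall (f : S) (a : 'I_(arity f) -> A), h (interp a) = interp (h \o a).

Record variables := Variables {
  variable :> Type;
  variables_denumerable : [set: variable] #= [set: nat]
}.

Inductive formula (S : signature) (V : Type) : Type :=
| Var of V
| App (f : S) of ('I_(arity f) -> formula S V).

Lemma formula_inhabited (S : signature) (V : variables) :
  inhabited (formula S V).
Proof.
have /card_set_bijP[g [_ _ gsurj]] := variables_denumerable V.
by have [v _ _] := gsurj 0 I; split; exact: Var v.
Qed.

Definition Fm (S : signature) (V : variables) : algebra S :=
  Algebra (formula_inhabited S V) (@App S V).

(* A logic is a structural closure operator on sets of formulas; it is not
   required to be finitary. *)
Record logic (S : signature) (V : variables) := Logic {
  consequences :> set (Fm S V) -> set (Fm S V);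
  consequences_extensive : forall X, X `<=` consequences X;
  consequences_monotone : forall X Y,
    X `<=` Y -> consequences X `<=` consequences Y;
  consequences_idempotent : forall X,
    consequences (consequences X) = consequences X;
  consequences_structural : forall (s : Fm S V -> Fm S V), homomorphism s ->
    forall X, s @` consequences X `<=` consequences (s @` X)
}.

Definition deductive_filters (S : signature) (V : variables) (L : logic S V)
    (A : algebra S) : set (set A) :=
  [set F | forall (X : set (Fm S V)) (p : Fm S V) (h : Fm S V -> A),
    homomorphism h -> L X p -> h @` X `<=` F -> F (h p)].
Arguments deductive_filters {S V} L A _.

Record congruence (S : signature) (A : algebra S) (t : set (A * A)) : Prop :=
  Congruence {
    congruence_refl : forall a, t (a, a);
    congruence_sym : forall a b, t (a, b) -> t (b, a);
    congruence_trans : forall a b c, t (a, b) -> t (b, c) -> t (a, c);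
    congruence_interp : forall (f : S) (a b : 'I_(arity f) -> A),
      (forall i, t (a i, b i)) -> t (interp a, interp b)
  }.

Definition compatible (T : Type) (t : set (T * T)) (F : set T) : Prop :=
  forall a b, t (a, b) -> F a -> F b.

Definition largest_compatible_congruence (S : signature) (A : algebra S)
    (F : set A) (t : set (A * A)) : Prop :=
  [/\ congruence t, compatible t F &
      forall u, congruence u -> compatible u F -> u `<=` t].

Lemma largest_compatible_congruence_exists (S : signature) (A : algebra S)
  (F : set A) : exists t, largest_compatible_congruence F t.
Proof.
pose U (a b : A) :=
  exists u : set (A * A), [/\ congruence u, compatible u F & u (a, b)].
pose T := clos_refl_sym_trans A U.
exists [set x | T x.1 x.2]; split; last first.
- by move=> u cu uF [a b] uab; apply: rst_step; exists u.
- move=> a b /= Tab; suff [] : F a <-> F b by [].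
  elim: Tab => {a b} [a b [u [cu uF uab]] //|a //|a b _ [? ?] //|].
  + by split; apply: uF => //; apply: congruence_sym.
  + by move=> a b c _ [? ?] _ [? ?]; split; auto.
split=> /= [a|a b|a b c|f a b Tab]; [exact: rst_refl|exact: rst_sym| |].
  exact: rst_trans.
pose upd (c : 'I_(arity f) -> A) i x := fun j => if j == i then x else c j.
have Tupd c i x y : T x y -> T (interp (upd c i x)) (interp (upd c i y)).
  elim=> {x y} [x y [u [cu uF uxy]]|x|x y _|x y z _ + _].
  - apply: rst_step; exists u; split=> //; apply: congruence_interp => // j.
    by rewrite /upd; case: ifP => // _; apply: congruence_refl.
  - exact: rst_refl.
  - exact: rst_sym.
  - exact: rst_trans.
pose mix k := fun j : 'I_(arity f) => if j < k then b j else a j.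
have Tmix k : k <= arity f -> T (interp a) (interp (mix k)).
  elim: k => [_|k IHk lek].
    rewrite (_ : mix 0 = a); first exact: rst_refl.
    by apply/funext => j; rewrite /mix ltn0.
  apply: (rst_trans _ _ _ (interp (mix k))); first exact/IHk/ltnW.
  pose i := Ordinal lek.
  rewrite (_ : mix k = upd (mix k) i (a i)); last first.
    apply/funext => j; rewrite /upd; case: eqP => // ->.
    by rewrite /mix /= ltnn.
  rewrite (_ : mix k.+1 = upd (mix k) i (b i)); first exact: Tupd.
  apply/funext => j; rewrite /upd; case: eqP => [->|/eqP ji].
    by rewrite /mix /= ltnSn.
  rewrite /mix ltnS leq_eqVlt.
  by rewrite (negbTE (_ : (j : nat) != k)).
have -> : b = mix (arity f) by apply/funext => j; rewrite /mix ltn_ord.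
exact: Tmix.
Qed.

Definition leibniz (S : signature) (A : algebra S) (F : set A) : set (A * A) :=
  sval (cid (largest_compatible_congruence_exists F)).

Lemma leibnizP (S : signature) (A : algebra S) (F : set A) :
  largest_compatible_congruence F (leibniz F).
Proof. exact: (svalP (cid (largest_compatible_congruence_exists F))). Qed.

(* The pair (A, F) belongs to Mod^* L. *)
Definition reduced_model (S : signature) (V : variables) (L : logic S V)
    (A : algebra S) (F : set A) : Prop :=
  deductive_filters L A F /\ leibniz F = diagonal.

Definition smallest_nonempty_filter (S : signature) (V : variables)
    (L : logic S V) (A : algebra S) (F : set A) : Prop :=
  [/\ deductive_filters L A F, F !=set0 &
      forall G, deductive_filters L A G -> G !=set0 -> F `<=` G].

Definition small_truth_sets (S : signature) (V : variables)
    (L : logic S V) : Prop :=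
  forall (A : algebra S) (F : set A),
    reduced_model L F -> smallest_nonempty_filter L F.

Definition almost_small_truth_sets (S : signature) (V : variables)
    (L : logic S V) : Prop :=
  forall (A : algebra S) (F : set A),
    reduced_model L F -> F !=set0 -> smallest_nonempty_filter L F.

Definition leibniz_order_reflecting (S : signature) (V : variables)
    (L : logic S V) (A : algebra S) : Prop :=
  forall F G : set A, deductive_filters L A F -> deductive_filters L A G ->
    leibniz F `<=` leibniz G -> F `<=` G.

Definition leibniz_almost_order_reflecting (S : signature) (V : variables)
    (L : logic S V) (A : algebra S) : Prop :=
  forall F G : set A, deductive_filters L A F -> deductive_filters L A G ->
    F !=set0 -> G !=set0 -> leibniz F `<=` leibniz G -> F `<=` G.

(* Main.v *)
(**
An order-reflecting Leibniz operator forces a reduced filter [F] below every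
filter [G], because [leibniz F] is the diagonal and hence below [leibniz G].
Conversely, if [leibniz F] is included in [leibniz G], then both filters descend
to the quotient by [leibniz F], where the image of [F] is reduced, hence
smallest, and the inclusion lifts back. The empty filter needs separate care:
its Leibniz congruence is total, so that its reduction is the empty filter on a
trivial algebra.
*)

From mathcomp Require Import all_boot.
From mathcomp Require Import boolp classical_sets.
Require Import Defs.

Set Implicit Arguments.
Unset Strict Implicit.
Unset Printing Implicit Defensive.

Local Open Scope classical_set_scope.

(** The extension of an assignment [v] to the homomorphism out of the formula algebra that freeness
    provides; its homomorphism equation holds by computation. *)
Fixpoint eval (S : signature) (V : Type) (A : algebra S) (v : V -> A)
    (p : formula S V) : A :=
  match p with
  | Var x => v x
  | App f ps => interp (fun i => eval v (ps i))
  end.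

Lemma homomorphism_comp (S : signature) (A B C : algebra S) (g : B -> C)
  (h : A -> B) : homomorphism g -> homomorphism h -> homomorphism (g \o h).
Proof. by move=> gP hP f a; rewrite /= hP gP. Qed.

Lemma Fm_homomorphism_eq (S : signature) (V : variables) (A : algebra S)
  (h k : Fm S V -> A) : homomorphism h -> homomorphism k ->
  (forall x : V, h (@Var S V x) = k (@Var S V x)) -> h =1 k.
Proof.
move=> hP kP hk; elim=> [x|f ps IH]; first exact: hk.
by rewrite (hP f ps) (kP f ps); congr interp; apply/funext.
Qed.

Lemma quotient_exists (S : signature) (A : algebra S) (t : set (A * A)) :
  congruence t ->
  exists (B : algebra S) (pi : A -> B),
    [/\ homomorphism pi, forall b, exists a, pi a = b &
        forall a b, pi a = pi b <-> t (a, b)].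
Proof.
move=> [tr ts tt ti].
pose cls a := [set b | t (a, b)].
have clsE a b : cls a = cls b <-> t (a, b).
  split=> [ab|ab]; first by rewrite -[t _]/(cls a b) ab; exact: tr.
  apply/seteqP; split=> c /=; last exact: tt.
  by apply: tt; exact: ts.
pose pi a : {X | exists a, cls a = X} := exist _ (cls a) (ex_intro _ a erefl).
have piE a b : pi a = pi b <-> t (a, b).
  by split=> [[/clsE]//|/clsE ab]; exact: eq_exist.
have pisurj X : exists a, pi a = X.
  by case: X => X [a aX]; exists a; exact: eq_exist.
have [rep repK] := choice pisurj.
have [a0] := carrier_inhabited A.
(* Operations on classes are computed on the representatives chosen by [rep]; since [t] is a
   congruence, the choice does not affect the resulting class. *)
exists (Algebra (inhabits (pi a0)) (fun f X => pi (interp (rep \o X)))), pi.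
split=> // f a; apply/piE/ti => i.
by apply/piE; rewrite repK.
Qed.

(** A homomorphism from formulas into [B] lifts through the surjection [pi], because formulas are
    free. Compatibility then pulls membership in the image back to [F] itself, where the rule can be
    applied. *)
Lemma deductive_filters_image (S : signature) (V : variables) (L : logic S V)
  (A B : algebra S) (pi : A -> B) (F : set A) : homomorphism pi ->
  (forall b, exists a, pi a = b) ->
  compatible [set x | pi x.1 = pi x.2] F ->
  deductive_filters L A F -> deductive_filters L B (pi @` F).
Proof.
move=> piP pisurj piF FP X p h hP Xp hX.
have [g gK] := choice pisurj.
(* [k] lifts [h]: each variable is sent to a [pi]-preimage of its value under [h]. *)
pose k := eval (fun x : V => g (h (@Var S V x))).
have kh : pi \o k =1 h.
  apply: Fm_homomorphism_eq => // [|x]; last by rewrite /= gK.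
  exact: homomorphism_comp.
exists (k p); last exact: kh.
apply: (FP X) => // _ [q Xq <-].
have [a Fa aq] := hX _ (imageP h Xq).
by apply: piF Fa; rewrite /= aq; apply/esym/kh.
Qed.

(** The Leibniz congruence of the image pulls back along [pi] to a congruence compatible with [F].
    By maximality it lies in [leibniz F], which is the kernel of [pi]. *)
Lemma leibniz_image (S : signature) (A B : algebra S) (pi : A -> B)
  (F : set A) : homomorphism pi -> (forall b, exists a, pi a = b) ->
  (forall a b, pi a = pi b <-> leibniz F (a, b)) ->
  leibniz (pi @` F) = diagonal.
Proof.
move=> piP pisurj piE.
have [_ cF maxF] := leibnizP F.
have [[tr ts tt ti] ct _] := leibnizP (pi @` F).
apply/seteqP; split=> [[b c]|[b c] /diagonalP ->]; last exact: tr.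
have [[a <-] [a' <-]] := (pisurj b, pisurj c).
move=> aa'; apply/piE.
apply: (maxF [set x | leibniz (pi @` F) (pi x.1, pi x.2)]) => //.
  split=> /= [x|x y|x y z|f x y xy]; [exact: tr|exact: ts|exact: tt|].
  by rewrite !piP; exact: ti.
move=> x y /= xy Fx.
have [z Fz zy] := ct _ _ xy (imageP pi Fx).
by apply: cF Fz; apply/piE.
Qed.

Lemma leibniz_set0 (S : signature) (A : algebra S) :
  leibniz (set0 : set A) = setT.
Proof.
have [_ _ max0] := leibnizP (set0 : set A).
by apply/seteqP; split=> // x _; apply: (max0 setT).
Qed.

Lemma deductive_filters_setT (S : signature) (V : variables) (L : logic S V)
  (A : algebra S) : deductive_filters L A setT.
Proof. by []. Qed.

Lemma diagonal_sub_leibniz (S : signature) (A : algebra S) (F : set A) :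
  diagonal `<=` leibniz F.
Proof.
by have [[tr _ _ _] _ _] := leibnizP F => -[a b] /diagonalP ->.
Qed.

(** Here [B] is the quotient by [leibniz F]. Any [G] with a larger Leibniz congruence is a union of
    classes, so it descends to a filter and inclusions between images lift back. *)
Lemma reduction_exists (S : signature) (V : variables) (L : logic S V)
  (A : algebra S) (F : set A) : deductive_filters L A F ->
  exists (B : algebra S) (pi : A -> B),
    [/\ reduced_model L (pi @` F),
        forall G, deductive_filters L A G -> leibniz F `<=` leibniz G ->
          deductive_filters L B (pi @` G) &
        forall G, leibniz F `<=` leibniz G ->
          pi @` F `<=` pi @` G -> F `<=` G].
Proof.
move=> FP; have [cF _ _] := leibnizP F.
have [B [pi [piP pisurj piE]]] := quotient_exists cF.
have kerG G : leibniz F `<=` leibniz G ->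
    compatible [set x | pi x.1 = pi x.2] G.
  have [_ cG _] := leibnizP G.
  by move=> FG a b /piE/FG; exact: cG.
exists B, pi; split=> [|G GP FG|G FG sub a Fa].
- split; last exact: leibniz_image.
  by apply: deductive_filters_image => //; exact: kerG.
- by apply: deductive_filters_image => //; exact: kerG.
- have [b Gb ba] := sub _ (imageP pi Fa).
  exact: (kerG G FG b a).
Qed.

Lemma almost_small_order_reflecting (S : signature) (V : variables)
  (L : logic S V) (A : algebra S) :
  almost_small_truth_sets L -> leibniz_almost_order_reflecting L A.
Proof.
move=> sL F G FP GP F0 G0 FG.
have [B [pi [red filt lift]]] := reduction_exists FP.
have [|_ _ least] := sL _ _ red; first exact: image_nonempty.
by apply: (lift G) => //; apply: least; [exact: filt|exact: image_nonempty].
Qed.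

Lemma small_filter_nonempty (S : signature) (V : variables) (L : logic S V)
  (A : algebra S) (F : set A) :
  small_truth_sets L -> deductive_filters L A F -> F !=set0.
Proof.
move=> sL FP; have [B [pi [red _ _]]] := reduction_exists FP.
(* Smallness makes the image of [F] non-empty, and a point of the image comes from a point of
   [F]. *)
by have [_ [_ [a Fa _]] _] := sL _ _ red; exists a.
Qed.

Lemma order_reflecting_filter_nonempty (S : signature) (V : variables)
  (L : logic S V) (A : algebra S) (F : set A) :
  leibniz_order_reflecting L A -> deductive_filters L A F -> F !=set0.
Proof.
move=> oL FP; apply/set0P/eqP => F0; rewrite F0 in FP.
have [a] := carrier_inhabited A.
(* Were the empty set a filter, its total Leibniz congruence would force the whole carrier, which is
   inhabited, into it. *)
apply: (oL setT set0 _ FP _ a I); first exact: deductive_filters_setT.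
by rewrite leibniz_set0.
Qed.

Lemma order_reflecting_almost_small (S : signature) (V : variables)
  (L : logic S V) : (forall A, leibniz_almost_order_reflecting L A) ->
  almost_small_truth_sets L.
Proof.
move=> oL A F [FP Fred] F0; split=> // G GP G0.
by apply: oL => //; rewrite Fred; exact: diagonal_sub_leibniz.
Qed.

Theorem theorem7p3 (S : signature) (V : variables) (L : logic S V) :
  (small_truth_sets L <->
   forall A : algebra S, leibniz_order_reflecting L A) /\
  (almost_small_truth_sets L <->
   forall A : algebra S, leibniz_almost_order_reflecting L A).
Proof.
split; split.
- move=> sL A F G FP GP.
  have asL : almost_small_truth_sets L by move=> B H HP _; exact: sL.
  (* No filter is empty under [sL], so the almost version covers all pairs of filters. *)
  apply: (almost_small_order_reflecting asL FP GP).
    exact: small_filter_nonempty FP.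
  exact: small_filter_nonempty GP.
- move=> oL A F FP.
  have F0 : F !=set0 by exact: order_reflecting_filter_nonempty (oL A) FP.1.
  apply: order_reflecting_almost_small F0 => //.
  by move=> B G H GP HP _ _; exact: oL.
- by move=> sL A; exact: almost_small_order_reflecting.
- exact: order_reflecting_almost_small.
Qed.
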